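(* Let $p$ be a prime, $m,s\ge 1$, let $\mathcal{C}=(C_1,\dots,C_s)$ generate the digital net $P(\mathcal{C})=\{\boldsymbol{x}_0,\dots,\boldsymbol{x}_{p^m-1}\}\subset[0,1)^s$ over $\mathbb{Z}_p$, and let $\mathcal{K}(\mathcal{C})\subset\mathbb{N}_0^s$ be the associated set of wavenumbers. Let $f:[0,1)^s\to\mathbb{C}$ and for $\boldsymbol{k}\in\mathcal{K}(\mathcal{C})$ put $$\widetilde f(\boldsymbol{k})=\frac1{p^m}\sum_{n=0}^{p^m-1} f(\boldsymbol{x}_n)\,\overline{\mathrm{wal}_{\boldsymbol{k}}(\boldsymbol{x}_n)}.$$ Define $G^{(0)}(n_0,\dots,n_{m-1})=f(\boldsymbol{x}_{n_0+n_1p+\cdots+n_{m-1}p^{m-1}})$ for $n_0,\dots,n_{m-1}\in\{0,\dots,p-1\}$, and for $r=1,2,\dots,m$, for all $h_0,\dots,h_{r-1},n_r,\dots,n_{m-1}\in\{0,\dots,p-1\}$, $$G^{(r)}(h_0,\dots,h_{r-1},n_r,\dots,n_{m-1})=\sum_{n_{r-1}=0}^{p-1}\omega_p^{-n_{r-1}h_{r-1}}\,G^{(r-1)}(h_0,\dots,h_{r-2},n_{r-1},n_r,\dots,n_{m-1}).$$ Then for every $\boldsymbol{k}\in\mathcal{K}(\mathcal{C})$, writing $\mathcal{C}\cdot\boldsymbol{k}=\vec h=(h_0,\dots,h_{m-1})^T$, $$\widetilde f(\boldsymbol{k})=\frac1{p^m}\,G^{(m)}(h_0,\dots,h_{m-1}).$$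 This recursion computes all $p^m$ numbers $\widetilde f(\boldsymbol{k})$, $\boldsymbol{k}\in\mathcal{K}(\mathcal{C})$, from the values $f(\boldsymbol{x}_0),\dots,f(\boldsymbol{x}_{p^m-1})$ in $O(m\,p^{m+1})$ operations, and the same numbers can be computed from these values in $O(m\,p^m\log p)$ operations (with absolute implied constants).
   Context: $p$ is prime, $\mathbb{Z}_p=\{0,\dots,p-1\}$ is the field with $p$ elements, $\mathbb{N}_0$ the non-negative integers, $\omega_p=e^{2\pi i/p}$. Digital net: $C_1,\dots,C_s$ are $m\times m$ matrices over $\mathbb{Z}_p$. For $0\le n<p^m$ with $n=n_0+n_1p+\cdots+n_{m-1}p^{m-1}$ (base $p$ digits) let $\vec n=(n_0,\dots,n_{m-1})^T\in\mathbb{Z}_p^m$, $(y_{j,n,1},\dots,y_{j,n,m})^T=C_j\vec n\in\mathbb{Z}_p^m$, $x_{j,n}=y_{j,n,1}p^{-1}+\cdots+y_{j,n,m}p^{-m}$, and $\boldsymbol{x}_n=(x_{1,n},\dots,x_{s,n})$. $P(\mathcal{C})$ is the family $\boldsymbol{x}_0,\dots,\boldsymbol{x}_{p^m-1}$. Walsh functions: for $k=k_0+k_1p+\cdots+k_{a-1}p^{a-1}\in\mathbb{N}_0$ and $x\in[0,1)$ with base $p$ expansion $x=x_1/p+x_2/p^2+\cdots$ (infinitely many $x_i\ne p-1$), $\mathrm{wal}_k(x)=\omega_p^{x_1k_0+\cdots+x_ak_{a-1}}$; for $\boldsymbol{k}\in\mathbb{N}_0^s$, $\boldsymbol{x}\in[0,1)^s$,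 $\mathrm{wal}_{\boldsymbol{k}}(\boldsymbol{x})=\prod_{j=1}^s\mathrm{wal}_{k_j}(x_j)$. Dual net cosets: for $\boldsymbol{k}\in\mathbb{N}_0^s$ with $k_j=k_{j,0}+k_{j,1}p+\cdots$ let $\vec k_j^{(m)}=(k_{j,0},\dots,k_{j,m-1})^T\in\mathbb{Z}_p^m$ and $\mathcal{C}\cdot\boldsymbol{k}=C_1^T\vec k_1^{(m)}+\cdots+C_s^T\vec k_s^{(m)}\in\mathbb{Z}_p^m$. For $\vec h\in\mathbb{Z}_p^m$ let $\mathcal{D}(\vec h)=\{\boldsymbol{k}\in\mathbb{N}_0^s:\mathcal{C}\cdot\boldsymbol{k}=\vec h\}$. Standing assumption: all $p^m$ sets $\mathcal{D}(\vec h)$ are non-empty. The set $\mathcal{K}(\mathcal{C})$: let $\nu(0)=0$, $\nu(k)=1+\max\{i:k_i\ne0\}$ for $k=k_0+k_1p+\cdots>0$, and $\nu(\boldsymbol{k})=\sum_{j=1}^s\nu(k_j)$. $\mathcal{K}(\mathcal{C})$ contains exactly one element of each $\mathcal{D}(\vec h)$, $\vec h\in\mathbb{Z}_p^m$: the element minimizing $\nu$ over $\mathcal{D}(\vec h)$, ties broken by taking the lexicographically smallest. Thus $|\mathcal{K}(\mathcal{C})|=p^m$. ''Operations'' means additions and multiplications of complex numbers, with fixed complex constants (such as powers of roots of unity) available; the correspondence $\boldsymbol{k}\leftrightarrow\vec h=\mathcal{C}\cdot\boldsymbol{k}$ is regarded as known. *)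

(* Defs.v *)
From HB Require Import structures.
From mathcomp Require Import all_boot all_order all_algebra.
From mathcomp Require Import complex.
From mathcomp Require Import reals exp trigo.

Set Implicit Arguments.
Unset Strict Implicit.
Unset Printing Implicit Defensive.

Import Order.TTheory GRing.Theory Num.Theory.
Local Open Scope ring_scope.

(** * Base p digits *)

(* Digits are counted from 0: n = \sum_i digit p n i * p ^ i. *)
Definition digit (p n i : nat) : nat := ((n %/ p ^ i) %% p)%N.

Definition digit_vec (p m n : nat) : 'cV['F_p]_m :=
  \col_(i < m) (digit p n i)%:R.

(* Inverse of [digit_vec p m] on {0, ..., p ^ m - 1}. *)
Definition vec_index (p m : nat) (v : 'cV['F_p]_m) : nat :=
  (\sum_(i < m) v i 0%R * p ^ i)%N.

(* The i-th coordinate, for i given as a natural number; it is 0 (and never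
   used) when i >= m. *)
Definition coordn (p m : nat) (v : 'cV['F_p]_m) (i : nat) : 'F_p :=
  if insub i is Some j then v j 0 else 0.

Definition set_coord (p m : nat) (v : 'cV['F_p]_m) (i : nat) (a : 'F_p) :
  'cV['F_p]_m := \col_(j < m) (if j == i :> nat then a else v j 0).

(** * Digital nets *)

(* The row i of C_j *m digit_vec n is the digit y_(j,n,i+1), the rows being
   numbered from 0. *)
Definition net_point (R : realType) (p m s : nat) (C : 'I_s -> 'M['F_p]_m)
    (n : nat) : 'rV[R]_s :=
  \row_(j < s) \sum_(i < m)
    (nat_of_ord ((C j *m digit_vec p m n) i 0))%:R * p%:R ^- i.+1.

(** * Walsh functions *)

(* exp (2 pi i / p) *)
Definition omega (R : realType) (p : nat) : R[i] :=
  (cos (2 * pi / p%:R) +i* sin (2 * pi / p%:R))%C.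

(* The digit x_i (i >= 1) of x in [0, 1[ is floor (p ^ i * x) mod p; these are
   the digits of the expansion in which infinitely many differ from p - 1. *)
Definition frac_digit (R : realType) (p : nat) (x : R) (i : nat) : nat :=
  (Num.truncn (p%:R ^+ i * x) %% p)%N.

(* A nonzero digit of k at position i forces i < k, so that the maximum ranges
   over all nonzero digits. *)
Definition nu (p k : nat) : nat :=
  (\max_(i < k | digit p k i != 0) i.+1)%N.

Definition nu_vec (p s : nat) (k : s.-tuple nat) : nat :=
  (\sum_(j < s) nu p (tnth k j))%N.

Definition wal (R : realType) (p k : nat) (x : R) : R[i] :=
  omega R p ^+ (\sum_(i < nu p k) frac_digit p x i.+1 * digit p k i)%N.

Definition wal_vec (R : realType) (p s : nat) (k : s.-tuple nat)
    (x : 'rV[R]_s) : R[i] :=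
  \prod_(j < s) wal p (tnth k j) (x 0 j).

(** * Cosets of the dual net and their representatives *)

Definition dual_mul (p m s : nat) (C : 'I_s -> 'M['F_p]_m)
    (k : s.-tuple nat) : 'cV['F_p]_m :=
  \sum_(j < s) (C j)^T *m digit_vec p m (tnth k j).

(* The order of [tuplelexi] is the lexicographic order. *)
Definition wavenumber (p m s : nat) (C : 'I_s -> 'M['F_p]_m)
    (k : s.-tuple nat) : Prop :=
  forall k' : s.-tuple nat, dual_mul C k' = dual_mul C k ->
    (nu_vec p k < nu_vec p k')%N \/
    nu_vec p k = nu_vec p k' /\
      ((k : s.-tuplelexi nat) <= (k' : s.-tuplelexi nat))%O.

(* A function on [0, 1[^s is represented by a function on R^s whose values
   outside [0, 1[^s are arbitrary; only its values on the net matter. *)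
Definition walsh_coef (R : realType) (p m s : nat) (C : 'I_s -> 'M['F_p]_m)
    (f : 'rV[R]_s -> R[i]) (k : s.-tuple nat) : R[i] :=
  (p ^ m)%:R^-1 *
  \sum_(n < p ^ m) f (net_point R C n) * (wal_vec p k (net_point R C n))^*%R.

(** * The recursion *)

(* G^(r) (h_0, ..., h_(r-1), n_r, ..., n_(m-1)), the arguments being the
   coordinates of v; meant for r <= m. *)
Fixpoint fft (R : realType) (p m s : nat) (C : 'I_s -> 'M['F_p]_m)
    (f : 'rV[R]_s -> R[i]) (r : nat) (v : 'cV['F_p]_m) {struct r} : R[i] :=
  match r with
  | 0 => f (net_point R C (vec_index v))
  | r'.+1 => \sum_(a : 'F_p)
      omega R p ^- (a * coordn v r')%N * fft C f r' (set_coord v r' a)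
  end.

(** * Counting operations: straight-line programs *)

(* The memory is a growing sequence of cells that initially holds the inputs.
   Each instruction is one operation and appends its result to the memory;
   constants are available for free. The number of operations of a program is
   its size. *)
Inductive operand (K : Type) := Const of K | Cell of nat.
Arguments Cell {K}.

Inductive instr (K : Type) :=
  | Add of operand K & operand K
  | Mul of operand K & operand K.

Definition slp (K : Type) := seq (instr K).

Definition operand_val (K : nzRingType) (mem : seq K) (o : operand K) : K :=
  match o with Const c => c | Cell i => nth 0 mem i end.

Definition instr_val (K : nzRingType) (mem : seq K) (o : instr K) : K :=
  match o with
  | Add x y => operand_val mem x + operand_val mem y
  | Mul x y => operand_val mem x * operand_val mem y
  end.

(* The final memory. *)
Definition run (K : nzRingType) (P : slp K) (inputs : seq K) : seq K :=
  foldl (fun mem o => rcons mem (instr_val mem o)) inputs P.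

Definition samples (R : realType) (p m s : nat) (C : 'I_s -> 'M['F_p]_m)
    (f : 'rV[R]_s -> R[i]) : seq R[i] :=
  [seq f (net_point R C n) | n <- iota 0 (p ^ m)].

(** * The recursion as a straight-line program *)

(* Adds to acc the sum of the w * cell c for (w, c) in l; the first free cell
   is L and the result is in the last cell written. *)
Fixpoint sum_of_products (K : Type) (acc : operand K) (L : nat)
    (l : seq (K * nat)) : slp K :=
  if l is (w, c) :: l' then
    [:: Mul (Const w) (Cell c), Add acc (Cell L)
      & sum_of_products (Cell L.+1) L.+2 l']
  else [::].

(* First cell used for computing the entry G^(r+1) (digit_vec p m n): the p ^ m
   inputs come first, then each entry takes 2 p operations. *)
Definition entry_start (p m r n : nat) : nat :=
  (p ^ m + (r * p ^ m + n) * (2 * p))%N.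

(* Cell that holds the entry G^(r) (v). *)
Definition entry_cell (p m r : nat) (v : 'cV['F_p]_m) : nat :=
  if r is r'.+1 then (entry_start p m r' (vec_index v).+1).-1
  else vec_index v.

(* Computes G^(r+1) (digit_vec p m n) from the cells holding G^(r). *)
Definition entry_program (R : realType) (p m r n : nat) : slp R[i] :=
  let v := digit_vec p m n in
  sum_of_products (Const 0) (entry_start p m r n)
    [seq (omega R p ^- (a * coordn v r)%N, entry_cell r (set_coord v r a))
       | a : 'F_p <- enum 'F_p].

(* G^(1), ..., G^(m) in succession, then the factor 1 / p ^ m. *)
Definition fft_program (R : realType) (p m : nat) : slp R[i] :=
  flatten [seq entry_program R p m r n | r <- iota 0 m, n <- iota 0 (p ^ m)]
  ++ [seq Mul (Const (p ^ m)%:R^-1) (Cell (entry_cell m (digit_vec p m n)))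
        | n <- iota 0 (p ^ m)].

(* Cell that holds G^(m) (h) / p ^ m. *)
Definition output_cell (p m : nat) (h : 'cV['F_p]_m) : nat :=
  (entry_start p m m 0 + vec_index h)%N.

(* Main.v *)
Require Import Defs.
From mathcomp Require Import all_boot all_order all_algebra.
From mathcomp Require Import boolp classical_sets.
From mathcomp Require Import complex reals exp trigo.
From mathcomp Require Import ring zify.

Set Implicit Arguments.
Unset Strict Implicit.
Unset Printing Implicit Defensive.

Import Order.TTheory GRing.Theory Num.Theory.
Local Open Scope classical_set_scope.
Local Open Scope ring_scope.

(** The digits of the j-th coordinate of the n-th net point are the entries of
    C_j n, so the j-th factor of the Walsh function wal_k at this point is a
    power of omega with exponent the inner product of C_j n and k_j. Summing
    over j and moving the matrices to the other side, the exponent becomes the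
    inner product of the digit vector of n with h = C . k, modulo p
    ([wal_vec_net_point]). Hence the Walsh coefficient is p ^ -m times the
    value at h of the Fourier transform of the samples over the group F_p ^ m,
    and the recursion is this transform taken one coordinate at a time:
    [fftE] is its closed form after r steps, and r = m gives [walsh_coef_fft].

    The correctness of the explicit program is an invariant of its execution
    ([fft_invariant]): when the program has produced the first n entries of
    the level r + 1, every entry of the levels up to r, and these n entries,
    sit in their cells. Its length is read off the size of the final memory.

    For the bound with log p, a step of the recursion is replaced, on each of
    the p ^ (m - 1) lines of F_p ^ m parallel to the r-th axis, by a Fourier
    transform of length p computed in O(p log p) operations. A prime length
    cannot be factored, so this transform is reduced to transforms of length
    L = 2 ^ k with 2 p <= L <= 4 p by
    Bluestein's trick: a h = binom(a + h, 2) - binom(a, 2) - binom(h, 2) turns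
    the transform into a correlation with the sequence z ^ binom(j, 2)
    ([computable_chirp]), which two transforms of length L diagonalize; these
    are computed by halving ([computable_dft2]). Costs are composed through a
    relation between sets of functions of the unknown data, [computable],
    which keeps cell addresses out of the argument. *)

(** * Base p digits *)

Lemma lt_sum_digits (p m : nat) (d : nat -> nat) :
  (forall i, (d i < p)%N) -> (\sum_(i < m) d i * p ^ i < p ^ m)%N.
Proof.
move=> dp; elim: m => [|m IH]; first by rewrite big_ord0.
rewrite big_ord_recr /= expnS.
apply: (@leq_trans ((d m).+1 * p ^ m)); last by rewrite leq_mul2r dp orbT.
by rewrite mulSn ltn_add2r.
Qed.

Lemma digit_sum (p m i : nat) (d : nat -> nat) :
  (forall i, (d i < p)%N) -> (i < m)%N ->
  digit p (\sum_(i < m) d i * p ^ i) i = d i.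
Proof.
move=> dp; elim: m => // m IH im; rewrite big_ord_recr /= /digit.
have p0 : (0 < p)%N by have := dp 0%N; lia.
move: im; rewrite ltnS leq_eqVlt => /orP[/eqP ->|im].
  rewrite addnC divnMDl ?expn_gt0 ?p0 //.
  by rewrite divn_small ?lt_sum_digits // addn0 modn_small.
have -> : (p ^ m = p ^ (m - i.+1) * p * p ^ i)%N.
  by rewrite -mulnA -expnS -expnD subnK.
rewrite mulnA addnC divnMDl ?expn_gt0 ?p0 // mulnA modnMDl.
exact: IH.
Qed.

Lemma sum_digit (p m n : nat) : (0 < p)%N -> (n < p ^ m)%N ->
  (\sum_(i < m) digit p n i * p ^ i)%N = n.
Proof.
move=> p0 nm; rewrite -[RHS](modn_small nm) {nm}.
elim: m => [|m IH]; first by rewrite big_ord0 expn0 modn1.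
rewrite big_ord_recr /= {}IH /digit.
rewrite [in RHS](divn_eq n (p ^ m)) [in RHS](divn_eq (n %/ p ^ m) p) expnS.
rewrite mulnDl -mulnA -addnA modnMDl [RHS]modn_small; first by rewrite addnC.
apply: (@leq_trans (((n %/ p ^ m) %% p).+1 * p ^ m)).
  by rewrite mulSnr ltn_add2l ltn_mod expn_gt0 p0.
by rewrite leq_mul2r ltn_mod p0 orbT.
Qed.

Lemma ltn_Fp (p : nat) (a : 'F_p) : prime p -> (a < p)%N.
Proof. by move=> pp; rewrite -[X in (_ < X)%N](Fp_cast pp). Qed.

Lemma coordnE (p m : nat) (v : 'cV['F_p]_m) (i : 'I_m) : coordn v i = v i 0.
Proof. by rewrite /coordn valK. Qed.

Lemma vec_index_lt (p m : nat) (v : 'cV['F_p]_m) :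
  prime p -> (vec_index v < p ^ m)%N.
Proof.
move=> pp; rewrite /vec_index.
under eq_bigr => i _ do rewrite -coordnE.
by apply: (@lt_sum_digits p m (fun i => coordn v i)) => i; apply: ltn_Fp.
Qed.

Lemma digit_vecK (p m : nat) : prime p ->
  cancel (@vec_index p m) (digit_vec p m).
Proof.
move=> pp v; apply/colP => i; rewrite mxE.
rewrite /vec_index; under eq_bigr => j _ do rewrite -coordnE.
rewrite (digit_sum (d := fun j => coordn v j)) //; last first.
  by move=> j; apply: ltn_Fp.
by rewrite coordnE natr_Zp.
Qed.

Lemma vec_indexK (p m n : nat) : prime p -> (n < p ^ m)%N ->
  vec_index (digit_vec p m n) = n.
Proof.
move=> pp nm; rewrite -[RHS](sum_digit (prime_gt0 pp) nm).
by apply: eq_bigr => i _; rewrite mxE val_Fp_nat // /digit modn_mod.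
Qed.

(** * Powers of omega *)

Lemma omegaX (R : realType) (p n : nat) :
  omega R p ^+ n = (cos (n%:R * (2 * pi / p%:R)) +i*
                    sin (n%:R * (2 * pi / p%:R)))%C.
Proof.
rewrite /omega; set t := 2 * pi / p%:R.
elim: n => [|n IH]; first by rewrite expr0 mul0r cos0 sin0.
rewrite exprS {}IH -[n.+1%:R]natr1 mulrDl mul1r cosD sinD.
by apply/eqP; rewrite eq_complex /=; apply/andP; split; apply/eqP; ring.
Qed.

Lemma omegaXp (R : realType) (p : nat) : (0 < p)%N -> omega R p ^+ p = 1.
Proof.
move=> p0; rewrite omegaX mulrCA divff ?pnatr_eq0 -?lt0n // mulr1.
by rewrite mulr_natl cos2pi sin2pi.
Qed.

Lemma omega_mod (R : realType) (p n : nat) : (0 < p)%N ->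
  omega R p ^+ (n %% p) = omega R p ^+ n.
Proof. by move=> p0; apply: expr_mod; apply: omegaXp. Qed.

Lemma omega_neq0 (R : realType) (p : nat) : (0 < p)%N -> omega R p != 0.
Proof.
move=> p0; apply/eqP => w0; have := @omegaXp R p p0.
by rewrite w0 expr0n eqn0Ngt p0 => /eqP; rewrite eq_sym oner_eq0.
Qed.

(** A root of unity has modulus 1. *)
Lemma conj_omega (R : realType) (p : nat) : (0 < p)%N ->
  (omega R p)^*%R = (omega R p)^-1.
Proof.
move=> p0; apply: (mulfI (omega_neq0 R p0)); rewrite divff ?omega_neq0 //.
have n1 : `|omega R p| = 1.
  by apply/eqP; rewrite -(pexpr_eq1 p0) // -normrX omegaXp // normr1.
by rewrite -normCK n1 expr1n.
Qed.

(** * Walsh functions at the points of the net *)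

Lemma truncn_divn (R : realType) (a b : nat) : (0 < b)%N ->
  Num.truncn (a%:R / b%:R : R) = (a %/ b)%N.
Proof.
move=> b0; apply: truncn_def.
have b0R : 0 < b%:R :> R by rewrite ltr0n.
rewrite ler_pdivlMr // ltr_pdivrMr // -!natrM ler_nat ltr_nat.
by rewrite leq_divM -ltn_divLR // ltnS leqnn.
Qed.

(** The coordinate is Y / p ^ m for an integer Y whose base p digits are the
    entries of y in reverse order, so p ^ (i + 1) times it has as integral part
    the quotient of Y by p ^ (m - i - 1). Both sides are 0 when i >= m. *)
Lemma frac_digit_net_point (R : realType) (p m s n i : nat)
    (C : 'I_s -> 'M['F_p]_m) (j : 'I_s) : prime p ->
  frac_digit p (net_point R C n 0 j) i.+1 = coordn (C j *m digit_vec p m n) i.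
Proof.
move=> pp; have p0 := prime_gt0 pp; rewrite mxE.
set y := C j *m _.
have p0R : p%:R != 0 :> R by rewrite pnatr_eq0 -lt0n.
pose Y := (\sum_(l < m) coordn y (m - l.+1) * p ^ l)%N.
have -> : \sum_(l < m) (y l 0 : nat)%:R * p%:R ^- l.+1 = Y%:R / (p ^ m)%:R :> R.
  rewrite /Y (reindex_inj rev_ord_inj) /= natr_sum mulr_suml.
  apply: eq_bigr => l _.
  have <- : coordn y (m - l.+1) = y (rev_ord l) 0.
    by rewrite /coordn -[(m - l.+1)%N]/(val (rev_ord l)) valK.
  have -> : (p ^ m = p ^ (m - l.+1).+1 * p ^ l)%N.
    by rewrite -expnD addSnnS subnK.
  rewrite natrM [in RHS]natrM invfM mulrACA divff ?mulr1 ?natrX //.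
  by rewrite expf_neq0.
rewrite /frac_digit.
case: (ltnP i m) => im.
  have -> : p%:R ^+ i.+1 * (Y%:R / (p ^ m)%:R) =
      Y%:R / (p ^ (m - i.+1))%:R :> R.
    rewrite -{1}(subnK im) expnD natrM invfM !natrX.
    by rewrite mulrCA mulrA mulrACA divff ?expf_neq0 // mulr1.
  rewrite truncn_divn ?expn_gt0 ?p0 // -/(digit _ _ _) /Y.
  rewrite (digit_sum (d := fun l => coordn y (m - l.+1))) //.
  - by congr (nat_of_ord (coordn y _)); lia.
  - by move=> l; apply: ltn_Fp.
  - by lia.
have -> : p%:R ^+ i.+1 * (Y%:R / (p ^ m)%:R) = (Y * p ^ (i - m) * p)%:R :> R.
  have -> : i.+1 = ((i - m).+1 + m)%N by rewrite addSn subnK.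
  rewrite exprD exprSr !natrM !natrX mulrACA divff ?expf_neq0 // mulr1.
  by rewrite mulrC mulrA.
by rewrite natrK modnMl /coordn insubF //; apply/negbTE; rewrite -leqNgt.
Qed.

Lemma digit_ge_nu (p k i : nat) : (1 < p)%N -> (nu p k <= i)%N ->
  digit p k i = 0%N.
Proof.
move=> p1 nui; apply: contraTeq nui => di; rewrite -ltnNge.
have ik : (i < k)%N.
  apply: leq_trans (ltn_expl i p1) _; rewrite leqNgt.
  by apply: contraNN di => ki; rewrite /digit divn_small // mod0n.
exact: (@leq_bigmax_cond _ _ (fun i : 'I_k => i.+1) (Ordinal ik) di).
Qed.

Lemma big_ord_tail0 (a b : nat) (F : nat -> nat) : (a <= b)%N ->
  (forall i, (a <= i)%N -> F i = 0%N) ->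
  (\sum_(i < b) F i = \sum_(i < a) F i)%N.
Proof.
move=> ab F0; rewrite -!(big_mkord predT) (big_cat_nat (n := a)) //=.
rewrite [X in (_ + X)%N]big_nat [X in (_ + X)%N]big1 ?addn0 // => i /andP[ai _].
exact: F0.
Qed.

Lemma eq_omega (R : realType) (p a b : nat) : prime p ->
  a%:R = b%:R :> 'F_p -> omega R p ^+ a = omega R p ^+ b.
Proof.
move=> pp ab; rewrite -omega_mod ?prime_gt0 // -[RHS]omega_mod ?prime_gt0 //.
by rewrite -!val_Fp_nat // ab.
Qed.

(** The digits of k beyond [nu p k] and those of the net point beyond m vanish,
    so that both sums have the same nonzero terms. *)
Lemma wal_net_point (R : realType) (p m s n k : nat) (C : 'I_s -> 'M['F_p]_m)
    (j : 'I_s) : prime p ->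
  wal p k (net_point R C n 0 j) =
  omega R p ^+ (\sum_(i < m) (C j *m digit_vec p m n) i 0%R * digit p k i)%N.
Proof.
move=> pp; rewrite /wal; congr (_ ^+ _).
under eq_bigr => i _ do rewrite frac_digit_net_point //.
set y := C j *m _.
pose F i := (coordn y i * digit p k i)%N.
rewrite -/(F _).
rewrite -(@big_ord_tail0 (nu p k) (m + nu p k) F) ?leq_addl //; last first.
  by move=> i /(digit_ge_nu (prime_gt1 pp)) di; rewrite /F di muln0.
rewrite (@big_ord_tail0 m) ?leq_addr //.
  by apply: eq_bigr => i _; rewrite /F /coordn valK.
by move=> i im; rewrite /F /coordn insubF //; apply/negbTE; rewrite -leqNgt.
Qed.

(** The exponents agree modulo p because the inner product of C_j n with k_j
    is that of n with the image of k_j under the transpose of C_j. *)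
Lemma wal_vec_net_point (R : realType) (p m s n : nat) (k : s.-tuple nat)
    (C : 'I_s -> 'M['F_p]_m) : prime p ->
  wal_vec p k (net_point R C n) =
  omega R p ^+ (\sum_(i < m) digit_vec p m n i 0%R * dual_mul C k i 0%R)%N.
Proof.
move=> pp; rewrite /wal_vec.
under eq_bigr => j _ do rewrite wal_net_point //.
rewrite -expr_sum; apply: eq_omega => //.
set v := digit_vec p m n.
have -> : (\sum_(i < m) v i 0%R * dual_mul C k i 0%R)%N%:R =
          ((dual_mul C k)^T *m v) 0 0 :> 'F_p.
  rewrite natr_sum mxE; apply: eq_bigr => i _.
  by rewrite natrM !natr_Zp mulrC [in RHS]mxE.
rewrite /dual_mul [(\sum_j _)^T]raddf_sum mulmx_suml summxE.
rewrite natr_sum; apply: eq_bigr => j _.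
rewrite /= trmx_mul trmxK -mulmxA mxE natr_sum; apply: eq_bigr => i _.
by rewrite natrM natr_Zp mulrC !mxE.
Qed.

Lemma sum_fin_cV (R : realType) (p m : nat) (F : nat -> R[i]) : prime p ->
  \sum_(n < p ^ m) F n = \sum_(v : 'cV['F_p]_m) F (vec_index v).
Proof.
move=> pp.
rewrite (reindex_onto (fun v => Ordinal (vec_index_lt v pp))
           (fun n : 'I_(p ^ m) => digit_vec p m n)) /=.
  by apply: eq_bigl => v; rewrite digit_vecK // eqxx.
by move=> n _; apply: val_inj; rewrite /= vec_indexK.
Qed.

(** * The recursion in closed form *)

(** After r steps the first r coordinates have been summed out, with the
    characters given by those of v, and the others are still those of v. *)
Lemma fftE (R : realType) (p m s : nat) (C : 'I_s -> 'M['F_p]_m)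
    (f : 'rV[R]_s -> R[i]) (r : nat) (v : 'cV['F_p]_m) :
  prime p -> (r <= m)%N ->
  fft C f r v = \sum_(u : 'cV['F_p]_m |
                      [forall i : 'I_m, (r <= i)%N ==> (u i 0 == v i 0)])
    omega R p ^- (\sum_(i < r) coordn u i * coordn v i)%N *
    f (net_point R C (vec_index u)).
Proof.
move=> pp; elim: r v => [|r IH] v rm /=.
  rewrite (big_pred1 v) => [|u]; first by rewrite big_ord0 expr0 invr1 mul1r.
  by apply/forallP/eqP => [uv|-> //]; apply/colP => i; apply/eqP; exact: uv.
rewrite (partition_big (fun u => coordn u r) predT) //=.
apply: eq_bigr => a _; rewrite IH ?(ltnW rm) // mulr_sumr.
apply: eq_big => [u|u].
  apply/forallP/andP => [uv|[/forallP uv /eqP ua] i].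
    split; last first.
      have := uv (Ordinal rm); rewrite leqnn mxE eqxx /= => /eqP <-.
      by rewrite -coordnE.
    apply/forallP => i; apply/implyP => ri; have := uv i.
    by rewrite mxE (ltnW ri) gtn_eqF.
  apply/implyP; rewrite leq_eqVlt mxE => /predU1P[ri|ri].
    by rewrite -ri eqxx -ua ri coordnE.
  by rewrite gtn_eqF //; have := uv i; rewrite ri.
move=> /forallP uv; rewrite big_ord_recr /= mulrA -invfM -exprD.
have -> : coordn u r = a.
  rewrite (coordnE u (Ordinal rm)); apply/eqP.
  by have := uv (Ordinal rm); rewrite leqnn mxE eqxx.
rewrite addnC; congr (_ ^- (_ + _) * _).
apply: eq_bigr => i _; congr (_ * _)%N.
have im : (i < m)%N by apply: ltn_trans (ltn_ord i) _.
by rewrite !(coordnE _ (Ordinal im)) mxE /= ltn_eqF.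
Qed.

Lemma walsh_coef_fft (R : realType) (p m s : nat) (C : 'I_s -> 'M['F_p]_m)
    (f : 'rV[R]_s -> R[i]) (k : s.-tuple nat) : prime p ->
  walsh_coef C f k = (p ^ m)%:R^-1 * fft C f m (dual_mul C k).
Proof.
move=> pp; rewrite /walsh_coef fftE //; congr (_ * _).
pose F n := omega R p ^-
  (\sum_(i < m) digit_vec p m n i 0%R * dual_mul C k i 0%R)%N *
  f (net_point R C n).
transitivity (\sum_(n < p ^ m) F n).
  apply: eq_bigr => n _; rewrite wal_vec_net_point // rmorphXn /= conj_omega.
    by rewrite exprVn mulrC.
  exact: prime_gt0.
rewrite sum_fin_cV //; apply: eq_big => [v|v _].
  by apply/esym/forallP => i; rewrite leqNgt ltn_ord.
rewrite /F digit_vecK //; congr (_ ^- _ * _).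
by apply: eq_bigr => i _; rewrite !coordnE.
Qed.

(** * Runs of straight-line programs *)

Lemma run_cat (K : nzRingType) (P Q : slp K) (mem : seq K) :
  run (P ++ Q) mem = run Q (run P mem).
Proof. exact: foldl_cat. Qed.

Lemma size_run (K : nzRingType) (P : slp K) (mem : seq K) :
  size (run P mem) = (size mem + size P)%N.
Proof.
elim: P mem => [|o P IH] mem /=; first by rewrite addn0.
by rewrite IH size_rcons addSnnS.
Qed.

Lemma nth_run (K : nzRingType) (P : slp K) (mem : seq K) (i : nat) :
  (i < size mem)%N -> nth 0 (run P mem) i = nth 0 mem i.
Proof.
elim: P mem => [|o P IH] mem //= im.
rewrite IH; first by rewrite nth_rcons im.
by rewrite size_rcons ltnS ltnW.
Qed.

(** The loop rule for programs generated by a counter. *)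
Lemma run_flatten_iota (K : nzRingType) (prog : nat -> slp K) (N : nat)
    (Inv : nat -> seq K -> Prop) (mem : seq K) :
  Inv 0%N mem ->
  (forall n mem', (n < N)%N -> Inv n mem' -> Inv n.+1 (run (prog n) mem')) ->
  Inv N (run (flatten [seq prog n | n <- iota 0 N]) mem).
Proof.
move=> Inv0; elim: N => // N IH InvS.
rewrite -addn1 iotaD map_cat flatten_cat run_cat /= cats0 addn1.
by apply: (InvS N) => //; apply: IH => n mem' nN; apply: InvS; apply: ltnW.
Qed.

(** The accumulator is kept general for the induction: it is a constant at the
    start and the last written cell afterwards. *)
Lemma run_sum_of_products (K : nzRingType) (acc : operand K)
    (l : seq (K * nat)) (mem : seq K) :
  (if acc is Cell i then (i < size mem)%N else true) ->
  all (fun x => x.2 < size mem)%N l ->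
  operand_val (run (sum_of_products acc (size mem) l) mem)
    (if l is [::] then acc else Cell (size mem + 2 * size l).-1) =
  operand_val mem acc + \sum_(x <- l) x.1 * nth 0 mem x.2.
Proof.
elim: l acc mem => [|[w c] l IH] acc mem acc_ok /= => [_|/andP[cm lm]].
  by rewrite big_nil addr0.
have ext x : operand_val (rcons mem x) acc = operand_val mem acc.
  by case: acc acc_ok => //= i im; rewrite nth_rcons im.
set mem1 := rcons mem _; set mem2 := rcons mem1 _.
have s1 : size mem1 = (size mem).+1 by rewrite size_rcons.
have s2 : size mem2 = (size mem).+2 by rewrite size_rcons s1.
have lt2 i : (i < size mem)%N -> nth 0 mem2 i = nth 0 mem i.
  by move=> im; rewrite nth_rcons s1 ltnS (ltnW im) nth_rcons im.
have v2 : nth 0 mem2 (size mem).+1 = operand_val mem acc + w * nth 0 mem c.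
  rewrite nth_rcons s1 ltnn eqxx /=; congr (_ + _).
    by rewrite ext.
  by rewrite nth_rcons ltnn eqxx.
have /(_ (Cell (size mem).+1)) := IH _ mem2; rewrite s2 => /(_ (leqnn _)).
have lm2 : all (fun x => x.2 < (size mem).+2)%N l.
  by apply: sub_all lm => x xm; rewrite ltnS ltnW // ltnW.
move=> /(_ lm2); rewrite /= v2 big_cons /= addrA.
rewrite (eq_big_seq (fun x => x.1 * nth 0 mem x.2)); last first.
  by move=> x /(allP lm) xm; rewrite lt2.
move=> <-; case: (l) => [|y l'] /=; first by rewrite muln1 addn2.
by rewrite mulnS addnA addn2.
Qed.

Corollary nth_run_sum_of_products (K : nzRingType) (l : seq (K * nat))
    (mem : seq K) : (0 < size l)%N -> all (fun x => x.2 < size mem)%N l ->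
  nth 0 (run (sum_of_products (Const 0) (size mem) l) mem)
    (size mem + 2 * size l).-1 = \sum_(x <- l) x.1 * nth 0 mem x.2.
Proof.
move=> l0 /(@run_sum_of_products _ (Const 0) _ _ isT); rewrite /= add0r => <-.
by case: l l0.
Qed.

Lemma size_sum_of_products (K : nzRingType) (acc : operand K) (L : nat)
    (l : seq (K * nat)) : size (sum_of_products acc L l) = (2 * size l)%N.
Proof. by elim: l acc L => [|[w c] l IH] acc L //=; rewrite IH mulnS. Qed.

(** * Correctness of the program for the recursion *)

(** Before the n-th entry of the level r + 1 is computed. The bound on the cells
    is what guarantees that later instructions leave them alone. *)
Definition fft_invariant (R : realType) (p m s : nat) (C : 'I_s -> 'M['F_p]_m)
    (f : 'rV[R]_s -> R[i]) (r n : nat) (mem : seq R[i]) : Prop :=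
  size mem = entry_start p m r n /\
  forall r' (v : 'cV['F_p]_m),
    (r' <= r)%N \/ r' = r.+1 /\ (vec_index v < n)%N ->
    (entry_cell r' v < size mem)%N /\
    nth 0 mem (entry_cell r' v) = fft C f r' v.

Lemma entry_startS (p m r n : nat) :
  entry_start p m r n.+1 = (entry_start p m r n + 2 * p)%N.
Proof. by rewrite /entry_start addnS mulSn addnCA addnC. Qed.

Lemma size_entry_program (R : realType) (p m r n : nat) : prime p ->
  size (entry_program R p m r n) = (2 * p)%N.
Proof.
by move=> pp; rewrite size_sum_of_products size_map -cardE card_Fp.
Qed.

Lemma fft_invariantS (R : realType) (p m s : nat) (C : 'I_s -> 'M['F_p]_m)
    (f : 'rV[R]_s -> R[i]) (r n : nat) (mem : seq R[i]) :
  prime p -> (n < p ^ m)%N -> fft_invariant C f r n mem ->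
  fft_invariant C f r n.+1 (run (entry_program R p m r n) mem).
Proof.
move=> pp nm [sz ok].
have szS : size (run (entry_program R p m r n) mem) = entry_start p m r n.+1.
  by rewrite size_run sz size_entry_program // entry_startS.
split=> // r' v r'v.
have [old|r'E] : ((r' <= r)%N \/ r' = r.+1 /\ (vec_index v < n)%N) \/
                 (r' = r.+1 /\ vec_index v = n).
- case: r'v => [|[->]]; first by left; left.
  by rewrite ltnS leq_eqVlt => /predU1P[->|vn]; [right|left; right].
- have [lt_cell <-] := ok _ _ old.
  by rewrite nth_run // size_run (leq_trans lt_cell) ?leq_addr.
case: r'E => -> vn; rewrite szS /= vn.
have pos : (0 < entry_start p m r n.+1)%N.
  by rewrite entry_startS ltn_addl // muln_gt0 (prime_gt0 pp).
split; first by rewrite prednK.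
rewrite /entry_program -sz.
set l := map _ _.
have sl : size l = p by rewrite size_map -cardE card_Fp.
have := @nth_run_sum_of_products _ l mem; rewrite sl sz -entry_startS.
move=> /(_ (prime_gt0 pp)) ->; last first.
  apply/allP => _ /mapP[a _ ->] /=; rewrite -sz.
  by have [] := ok r (set_coord (digit_vec p m n) r a) (or_introl (leqnn r)).
rewrite /l -vn digit_vecK // big_map big_enum; apply: eq_bigr => a _ /=.
by have [_ ->] := ok r (set_coord v r a) (or_introl (leqnn r)).
Qed.

Lemma run_fft_levels (R : realType) (p m s : nat) (C : 'I_s -> 'M['F_p]_m)
    (f : 'rV[R]_s -> R[i]) (r : nat) : prime p ->
  fft_invariant C f r 0
    (run (flatten [seq entry_program R p m r n | r <- iota 0 r,
                                                 n <- iota 0 (p ^ m)])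
      (samples C f)).
Proof.
move=> pp; elim: r => [|r IH].
  split; first by rewrite size_map size_iota /entry_start !(mul0n, addn0).
  move=> r' v [|[_]]; last by rewrite ltn0.
  rewrite leqn0 => /eqP -> /=; rewrite size_map size_iota vec_index_lt //.
  by rewrite (nth_map 0%N) ?size_iota ?vec_index_lt // nth_iota ?vec_index_lt.
rewrite -addn1 iotaD allpairs_cat flatten_cat run_cat /= cats0 addn1.
have [|sz ok] := run_flatten_iota (N := p ^ m)
  (Inv := fft_invariant C f r) (prog := entry_program R p m r) IH.
  by move=> n mem nm; apply: fft_invariantS.
split; first by rewrite sz /entry_start addn0 [(r.+1 * _)%N]mulSnr.
move=> r' v [|[_]]; last by rewrite ltn0.
rewrite leq_eqVlt => /predU1P[->|r'r]; apply: ok; last by left.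
by right; rewrite vec_index_lt.
Qed.

Lemma run_fft_program (R : realType) (p m s : nat) (C : 'I_s -> 'M['F_p]_m)
    (f : 'rV[R]_s -> R[i]) : prime p ->
  let mem := run (fft_program R p m) (samples C f) in
  [/\ size mem = (entry_start p m m 0 + p ^ m)%N,
      forall r (v : 'cV['F_p]_m), (r <= m)%N ->
        nth 0 mem (entry_cell r v) = fft C f r v
    & forall v : 'cV['F_p]_m,
        nth 0 mem (output_cell v) = (p ^ m)%:R^-1 * fft C f m v].
Proof.
move=> pp; rewrite /fft_program run_cat.
have [sz ok] := run_fft_levels C f m pp.
set mem0 := run _ _ in sz ok *.
pose Inv n (mem : seq R[i]) :=
  [/\ size mem = (entry_start p m m 0 + n)%N,
      forall r (v : 'cV['F_p]_m), (r <= m)%N ->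
        nth 0 mem (entry_cell r v) = fft C f r v
    & forall v : 'cV['F_p]_m, (vec_index v < n)%N ->
        nth 0 mem (output_cell v) = (p ^ m)%:R^-1 * fft C f m v].
have in_mem r (v : 'cV['F_p]_m) : (r <= m)%N -> (entry_cell r v < size mem0)%N.
  by move=> rm; have [] := ok r v (or_introl rm).
rewrite -[map _ _]flatten_seq1 -map_comp.
have [|n mem nm [szm okm outm]|szf okf outf] := @run_flatten_iota _
  (fun n => [:: Mul (Const (p ^ m)%:R^-1)
                    (Cell (entry_cell m (digit_vec p m n)))])
  (p ^ m) Inv mem0.
- split=> [|r v rm|//]; first by rewrite sz addn0.
  by have [] := ok r v (or_introl rm).
- split=> [|r v rm|v].
  + by rewrite /= size_rcons szm addnS.
  + by rewrite nth_run ?okm // szm -sz ltn_addr // in_mem.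
  + rewrite ltnS leq_eqVlt => /predU1P[vn|vn].
      rewrite /= nth_rcons szm /output_cell vn ltnn eqxx -vn digit_vecK //.
      by rewrite okm.
    by rewrite nth_run ?outm // szm ltn_add2l.
by split=> // v; apply: outf; apply: vec_index_lt.
Qed.

(** The size does not depend on the net, so it can be measured on a run with
    dimension 0 and zero samples. *)
Lemma size_fft_program (R : realType) (p m : nat) : prime p ->
  size (fft_program R p m) = (m * p ^ m * (2 * p) + p ^ m)%N.
Proof.
move=> pp.
have [+ _ _] := @run_fft_program R p m 0 (fun=> 0) (fun=> 0) pp.
rewrite size_run size_map size_iota /entry_start addn0 -addnA.
by move=> /addnI.
Qed.

(** * Cost of computing a set of functions *)

(** The value of g at the unknown data e is in a cell whose address does not
    depend on e. *)
Definition stored (K : nzRingType) (E : Type) (init : E -> seq K) (P : slp K)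
    (g : E -> K) : Prop :=
  exists2 i, forall e, (i < size (run P (init e)))%N
           & forall e, nth 0 (run P (init e)) i = g e.

(** c further operations suffice to get all of B, whatever the program that has
    already produced all of A. Since cells are never overwritten, A is still
    available afterwards, so results can be shared at no cost. *)
Definition computable (K : nzRingType) (E : Type) (init : E -> seq K) (c : nat)
    (A B : set (E -> K)) : Prop :=
  forall P, (forall g, A g -> stored init P g) ->
  exists2 Q, (size Q <= c)%N & forall g, B g -> stored init (P ++ Q) g.

Lemma stored_cat (K : nzRingType) (E : Type) (init : E -> seq K) (P Q : slp K)
    (g : E -> K) : stored init P g -> stored init (P ++ Q) g.
Proof.
move=> [i im gi]; exists i => e; rewrite run_cat; last by rewrite nth_run.
by rewrite size_run ltn_addr.
Qed.

Lemma computable_sub (K : nzRingType) (E : Type) (init : E -> seq K) (c : nat)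
    (A B : set (E -> K)) : B `<=` A -> computable init c A B.
Proof.
by move=> BA P PA; exists [::] => // g /BA/PA; rewrite cats0.
Qed.

Lemma computable_le (K : nzRingType) (E : Type) (init : E -> seq K)
    (c c' : nat) (A A' B B' : set (E -> K)) :
  (c <= c')%N -> A `<=` A' -> B' `<=` B ->
  computable init c A B -> computable init c' A' B'.
Proof.
move=> cc AA BB AB P PA; have [|Q Qc QB] := AB P; first by move=> g /AA/PA.
by exists Q; [apply: leq_trans cc|move=> g /BB/QB].
Qed.

Lemma computable_trans (K : nzRingType) (E : Type) (init : E -> seq K)
    (c d : nat) (A B C : set (E -> K)) :
  computable init c A B -> computable init d B C ->
  computable init (c + d) A C.
Proof.
move=> AB BC P PA; have [Q Qc QB] := AB P PA; have [Q' Qd QC] := BC _ QB.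
by exists (Q ++ Q'); [rewrite size_cat leq_add|move=> g /QC; rewrite catA].
Qed.

Lemma computableU (K : nzRingType) (E : Type) (init : E -> seq K)
    (c d : nat) (A B C : set (E -> K)) :
  computable init c A B -> computable init d A C ->
  computable init (c + d) A (B `|` C).
Proof.
move=> AB AC P PA; have [Q Qc QB] := AB P PA.
have [|Q' Qd QC] := AC (P ++ Q); first by move=> g /PA; apply: stored_cat.
exists (Q ++ Q'); first by rewrite size_cat leq_add.
by move=> g []; [move=> /QB gQ; rewrite catA; apply: stored_cat
                |move=> /QC; rewrite catA].
Qed.

Lemma computable_bigcup (K : nzRingType) (E : Type) (init : E -> seq K)
    (T : eqType) (s : seq T) (c : nat) (A : set (E -> K))
    (B : T -> set (E -> K)) :
  (forall t, t \in s -> computable init c A (B t)) ->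
  computable init (size s * c) A [set g | exists2 t, t \in s & B t g].
Proof.
elim: s => [|t s IH] AB; first by apply: computable_sub => g [].
rewrite mulSn.
apply: (computable_le _ _ _ (computableU (AB t (mem_head _ _)) (IH _))) => //.
  by move=> g [t'] /[!inE] /predU1P[->|ts] Bg; [left|right; exists t'].
by move=> t' ts; apply: AB; rewrite inE ts orbT.
Qed.

(** As the inputs have a constant size, the cell written by the operation has
    the same address for all data. *)
Lemma computable_op (K : nzRingType) (E : Type) (init : E -> seq K)
    (N : nat) (A : set (E -> K)) (g : E -> K) :
  (forall e, size (init e) = N) ->
  (forall P, (forall h, A h -> stored init P h) ->
    exists o, forall e, instr_val (run P (init e)) o = g e) ->
  computable init 1 A [set g].
Proof.
move=> sN op P PA; have [o og] := op P PA.
exists [:: o] => // _ ->; exists (N + size P)%N => e; rewrite run_cat /=.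
  by rewrite size_rcons size_run sN.
by rewrite nth_rcons size_run sN ltnn eqxx.
Qed.

Lemma computable_cst (K : nzRingType) (E : Type) (init : E -> seq K) (N : nat)
    (A : set (E -> K)) (c : K) : (forall e, size (init e) = N) ->
  computable init 1 A [set fun=> c].
Proof.
move=> sN; apply: (computable_op sN) => P _.
by exists (Add (Const c) (Const 0)) => e /=; rewrite addr0.
Qed.

Lemma computable_scale (K : nzRingType) (E : Type) (init : E -> seq K) (N : nat)
    (A : set (E -> K)) (c : K) (x : E -> K) :
  (forall e, size (init e) = N) -> A x ->
  computable init 1 A [set fun e => c * x e].
Proof.
move=> sN Ax; apply: (computable_op sN) => P /(_ x Ax)[i _ xi].
by exists (Mul (Const c) (Cell i)) => e /=; rewrite xi.
Qed.

Lemma computable_axpy (K : nzRingType) (E : Type) (init : E -> seq K) (N : nat)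
    (A : set (E -> K)) (c : K) (x y : E -> K) :
  (forall e, size (init e) = N) -> A x -> A y ->
  computable init 2 A [set fun e => x e + c * y e].
Proof.
move=> sN Ax Ay.
have AyA := computableU (computable_scale c sN Ay) 
  (@computable_sub _ _ init 0 A A (@subset_refl _ A)).
apply: (computable_trans (c := 1 + 0) (d := 1) AyA).
apply: (computable_op sN) => P PA.
have [i _ xi] := PA x (or_intror Ax); have [j _ yj] := PA _ (or_introl erefl).
by exists (Add (Cell i) (Cell j)) => e /=; rewrite xi yj.
Qed.

(** * Fourier transforms of length 2 ^ k *)

Definition first_terms (K : nzRingType) (E : Type) (n : nat)
    (x : nat -> E -> K) : set (E -> K) :=
  [set g | exists2 a, (a < n)%N & g = x a].

Lemma computable_first_terms (K : nzRingType) (E : Type) (init : E -> seq K)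
    (n c : nat) (A : set (E -> K)) (x : nat -> E -> K) :
  (forall a, (a < n)%N -> computable init c A [set x a]) ->
  computable init (n * c) A (first_terms n x).
Proof.
move=> Ax.
have := @computable_bigcup _ _ init _ (iota 0 n) c A (fun a => [set x a]).
rewrite size_iota => An.
apply: (computable_le (leqnn _) (@subset_refl _ A) _ (An _)) => [_ [a an ->]|a].
  by exists a => //; rewrite mem_iota.
by rewrite mem_iota => /andP[_]; apply: Ax.
Qed.

Lemma sum_even_odd (V : nmodType) (n : nat) (F : nat -> V) :
  \sum_(a < 2 * n) F a = \sum_(a < n) (F (2 * a)%N + F (2 * a).+1).
Proof.
elim: n => [|n IH]; first by rewrite muln0 !big_ord0.
by rewrite mulnS !big_ord_recr /= IH addrA.
Qed.

(** The radix-2 recursion. The output h combines the outputs h modulo 2 ^ k of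
    the transforms of the even and odd terms with the root z ^ 2; this takes 2
    operations for each of the 2 ^ (k + 1) outputs, and T(k + 1) =
    2 T(k) + 2 * 2 ^ (k + 1) is solved by T(k) = 2 k 2 ^ k. *)
Lemma computable_dft2 (K : comNzRingType) (E : Type) (init : E -> seq K)
    (N k : nat) (z : K) (x : nat -> E -> K) :
  (forall e, size (init e) = N) -> z ^+ (2 ^ k) = 1 ->
  computable init (2 * k * 2 ^ k) (first_terms (2 ^ k) x)
    (first_terms (2 ^ k) (fun h e => \sum_(a < 2 ^ k) z ^+ (a * h) * x a e)).
Proof.
move=> sN; elim: k z x => [|k IH] z x.
  rewrite muln0 mul0n expn0 => _; apply: computable_sub => _ [h h1 ->].
  exists 0%N => //; apply/funext => e.
  by rewrite big_ord1 mul0n expr0 mul1r.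
rewrite expnS => z1.
have z1' : (z ^+ 2) ^+ (2 ^ k) = 1 by rewrite -exprM.
pose even h e := \sum_(a < 2 ^ k) (z ^+ 2) ^+ (a * h) * x (2 * a)%N e.
pose odd h e := \sum_(a < 2 ^ k) (z ^+ 2) ^+ (a * h) * x (2 * a).+1%N e.
have half y : first_terms (2 ^ k) y `<=` first_terms (2 * 2 ^ k) x ->
    computable init (2 * k * 2 ^ k) (first_terms (2 * 2 ^ k) x)
      (first_terms (2 ^ k)
        (fun h e => \sum_(a < 2 ^ k) (z ^+ 2) ^+ (a * h) * y a e)).
  by move=> yx; apply: computable_le (IH (z ^+ 2) y z1').
have Ceven : computable init (2 * k * 2 ^ k) (first_terms (2 * 2 ^ k) x)
    (first_terms (2 ^ k) even).
  apply: (half (fun a => x (2 * a)%N)) => _ [a ak ->].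
  by exists (2 * a)%N => //; lia.
have Codd : computable init (2 * k * 2 ^ k) (first_terms (2 * 2 ^ k) x)
    (first_terms (2 ^ k) odd).
  apply: (half (fun a => x (2 * a).+1)) => _ [a ak ->].
  by exists (2 * a).+1 => //; lia.
have -> : (2 * k.+1 * (2 * 2 ^ k) =
    (2 * k * 2 ^ k + 2 * k * 2 ^ k) + 2 * 2 ^ k * 2)%N by ring.
apply: computable_trans (computableU Ceven Codd) _.
apply: computable_first_terms => h hk.
have -> : (fun e => \sum_(a < 2 * 2 ^ k) z ^+ (a * h) * x a e) =
          (fun e => even (h %% 2 ^ k)%N e + z ^+ h * odd (h %% 2 ^ k)%N e).
  apply/funext => e.
  have modk a : (z ^+ 2) ^+ (a * (h %% 2 ^ k)) = (z ^+ 2) ^+ (a * h).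
    by rewrite -(expr_mod _ z1') modnMmr expr_mod.
  rewrite /even /odd mulr_sumr -big_split /=.
  rewrite (sum_even_odd _ (fun a => z ^+ (a * h) * x a e)).
  apply: eq_bigr => a _; rewrite !modk mulrA -exprM -exprD.
  by rewrite mulSn mulnA.
apply: (computable_axpy _ sN); [left|right].
  by exists (h %% 2 ^ k)%N => //; rewrite ltn_mod expn_gt0.
by exists (h %% 2 ^ k)%N => //; rewrite ltn_mod expn_gt0.
Qed.

(** * The chirp transform *)

(** Fourier inversion on the cyclic group of order L. *)
Lemma prim_root_inversion (K : fieldType) (L : nat) (zeta : K) (c : nat -> K)
    (q : nat) : L.-primitive_root zeta -> L%:R != 0 :> K -> (q < L)%N ->
  \sum_(t < L) (L%:R^-1 * \sum_(j < L) zeta ^- (t * j) * c j) * zeta ^+ (t * q)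
  = c q.
Proof.
move=> prim L0 qL.
have zeta0 : zeta != 0.
  apply/eqP => z0; have := prim_expr_order prim; rewrite z0 expr0n.
  by rewrite (gtn_eqF (prim_order_gt0 prim)) => /eqP; rewrite eq_sym oner_eq0.
under eq_bigr => t _ do rewrite -mulrA mulr_suml.
rewrite -mulr_sumr exchange_big /= (bigD1 (Ordinal qL)) //= [X in _ + X]big1.
  rewrite addr0; under eq_bigr => t _ do
    rewrite mulrAC mulVf ?expf_neq0 // mul1r.
  by rewrite sumr_const card_ord -[c q *+ L]mulr_natl mulKf.
move=> j jq; pose w := zeta ^+ q / zeta ^+ j.
have w1 : w - 1 != 0.
  rewrite subr_eq0; apply: contraNneq jq => w1.
  have : zeta ^+ q == zeta ^+ j.
    by rewrite -[zeta ^+ j]mul1r -w1 /w divfK // expf_neq0.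
  rewrite (eq_prim_root_expr prim) !modn_small // => /eqP qj.
  exact/eqP/val_inj.
have wL : w ^+ L = 1.
  rewrite /w expr_div_n -!exprM ![(_ * L)%N]mulnC !exprM.
  by rewrite (prim_expr_order prim) !expr1n divr1.
transitivity (c j * \sum_(t < L) w ^+ t).
  rewrite mulr_sumr; apply: eq_bigr => t _.
  rewrite mulrAC mulrC; congr (_ * _).
  by rewrite /w expr_div_n -!exprM mulrC ![(t * _)%N]mulnC.
suff -> : \sum_(t < L) w ^+ t = 0 by rewrite mulr0.
by apply: (mulfI w1); rewrite -subrX1 wL subrr mulr0.
Qed.

Lemma bin2_add (a h : nat) : ('C(a + h, 2) = 'C(a, 2) + 'C(h, 2) + a * h)%N.
Proof.
elim: a => [|a IH]; first by rewrite bin0n mul0n addn0.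
by rewrite addSn !binS IH !bin1 mulSn; lia.
Qed.

(** Bluestein's algorithm, for an arbitrary nonzero z. With b_j =
    z ^ binom(j, 2), the output h is the correlation of the sequences
    x_a / b_a and b, taken at h and divided by b_h. Since a + h < L = 2 ^ k, no
    index wraps around, and the correlation is obtained from the transform of
    length L of x / b, padded with zeros, by multiplying it with the constants
    c_t below and transforming again: by inversion, the second transform with
    the same root zeta produces the b_(a + h). *)
Lemma computable_chirp (K : fieldType) (E : Type) (init : E -> seq K)
    (N k n : nat) (zeta z : K) (x : nat -> E -> K) :
  (forall e, size (init e) = N) ->
  (2 ^ k).-primitive_root zeta -> (2 ^ k)%:R != 0 :> K -> z != 0 ->
  (2 * n <= 2 ^ k)%N ->
  computable init (4 * k * 2 ^ k + 2 ^ k + 2 * n + 1) (first_terms n x)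
    (first_terms n (fun h e => \sum_(a < n) z ^+ (a * h) * x a e)).
Proof.
set L := (2 ^ k)%N => sN prim L0 z0 nL.
pose b a := z ^+ 'C(a, 2).
have b0 a : b a != 0 by rewrite expf_neq0.
pose u a : E -> K := if (a < n)%N then fun e => (b a)^-1 * x a e else fun=> 0.
pose U t e := \sum_(a < L) zeta ^+ (a * t) * u a e.
(* c is the inverse transform of b. *)
pose c t := L%:R^-1 * \sum_(j < L) zeta ^- (t * j) * b j.
pose V t e := c t * U t e.
pose W h e := \sum_(t < L) zeta ^+ (t * h) * V t e.
have zetaL := prim_expr_order prim.
have -> : (4 * k * L + L + 2 * n + 1 =
  (n * 1 + 1) + (2 * k * L + (L * 1 + (2 * k * L + n * 1))))%N by ring.
apply: (computable_trans (B := first_terms L u)).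
  apply: (@computable_le _ _ _ (n * 1 + 1) _ (first_terms n x) (first_terms n x)
    (first_terms n (fun a e => (b a)^-1 * x a e) `|` [set fun=> 0])
    (first_terms L u)) => //.
    move=> _ [a aL ->]; rewrite /u; case: ifP => an; [left|by right].
    by exists a.
  apply: computableU; last exact: computable_cst.
  apply: computable_first_terms => a an.
  by apply: (computable_scale _ sN); exists a.
apply: (computable_trans (B := first_terms L U)
  (computable_dft2 (x := u) sN zetaL)).
apply: (computable_trans (B := first_terms L V)).
  apply: computable_first_terms => t tL.
  by apply: (computable_scale _ sN); exists t.
apply: (computable_trans (B := first_terms L W)
  (computable_dft2 (x := V) sN zetaL)).
apply: computable_first_terms => h hn.
have -> : (fun e => \sum_(a < n) z ^+ (a * h) * x a e) =
          (fun e => (b h)^-1 * W h e); last first.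
  by apply: (computable_scale _ sN); exists h => //; lia.
apply/funext => e; apply: (mulfI (b0 h)); rewrite mulVKf // mulr_sumr.
have -> : W h e = \sum_(a < L) b (a + h)%N * u a e.
  rewrite /W /V /U; under eq_bigr => t _ do rewrite mulrA mulr_sumr.
  rewrite exchange_big /=; apply: eq_bigr => a _.
  have [an|na] := ltnP a n; last first.
    by rewrite /u ltnNge na mulr0 big1 // => t _; rewrite !mulr0.
  rewrite -(prim_root_inversion b prim L0 (q := a + h)); last by lia.
  rewrite mulr_suml; apply: eq_bigr => t _.
  rewrite -/(c t) mulnDr exprD [(t * a)%N]mulnC; ring.
rewrite (big_ord_widen L (fun a => b h * (z ^+ (a * h) * x a e))); last by lia.
rewrite big_mkcond; apply: eq_bigr => a _; rewrite /u.
case: ifP => an; last by rewrite mulr0.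
rewrite [b (a + h)%N](_ : _ = b a * b h * z ^+ (a * h)).
  by field.
by rewrite /b bin2_add !exprD.
Qed.

(** * Fast evaluation of the recursion *)

(** The order of omega divides 2 ^ k, and it is not a smaller power of 2 because
    the power 2 ^ (k - 1) of omega is exp (i pi) = -1. *)
Lemma prim_root_omega (R : realType) (k : nat) :
  (2 ^ k).-primitive_root (omega R (2 ^ k)).
Proof.
have L0 : (0 < 2 ^ k)%N by rewrite expn_gt0.
have [n prim /dvdn_pfactor] := prim_order_exists L0 (@omegaXp R _ L0).
move=> /(_ isT)[j jk nE]; move: jk; rewrite leq_eqVlt => /predU1P[jk|].
  by rewrite -{1}jk -nE.
case: k prim {L0} => // k prim; rewrite ltnS => jk.
have : omega R (2 ^ k.+1) ^+ (2 ^ k) = 1.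
  by apply/eqP; rewrite -(prim_order_dvd prim) nE dvdn_exp2l.
rewrite omegaX (_ : _ * _ = pi).
  rewrite cospi sinpi => /eqP; rewrite eq_complex /= => /andP[/eqP] /esym/eqP.
  by rewrite -subr_eq0 opprK -(natrD R 1 1) pnatr_eq0.
rewrite expnS natrM; field.
by rewrite pnatr_eq0 expn_eq0.
Qed.

Lemma set_coord_set_coord (p m : nat) (v : 'cV['F_p]_m) (i : nat) (a b : 'F_p) :
  set_coord (set_coord v i a) i b = set_coord v i b.
Proof. by apply/colP => j; rewrite !mxE; case: eqP. Qed.

Lemma set_coord_id (p m : nat) (v : 'cV['F_p]_m) (i : nat) :
  set_coord v i (coordn v i) = v.
Proof.
apply/colP => j; rewrite !mxE; case: eqP => // <-.
by rewrite coordnE.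
Qed.

Lemma coordn_set_coord (p m : nat) (v : 'cV['F_p]_m) (i : nat) (a : 'F_p) :
  (i < m)%N -> coordn (set_coord v i a) i = a.
Proof. by move=> im; rewrite (coordnE _ (Ordinal im)) mxE eqxx. Qed.

Lemma sum_Fp (V : nmodType) (p : nat) (F : 'F_p -> V) : prime p ->
  \sum_(a : 'F_p) F a = \sum_(a < p) F a%:R.
Proof.
move=> pp; apply/esym.
rewrite (reindex_onto (fun a => Ordinal (ltn_Fp a pp))
           (fun n : 'I_p => n%:R : 'F_p)) /=.
  by apply: eq_big => [a|a _]; rewrite natr_Zp ?eqxx.
by move=> n _; apply: val_inj; rewrite /= val_Fp_nat // modn_small.
Qed.

Lemma fft_step (R : realType) (p m s : nat) (C : 'I_s -> 'M['F_p]_m)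
    (f : 'rV[R]_s -> R[i]) (r h : nat) (v : 'cV['F_p]_m) :
  prime p -> (r < m)%N -> (h < p)%N ->
  fft C f r.+1 (set_coord v r h%:R) =
  \sum_(a < p) (omega R p)^-1 ^+ (a * h) * fft C f r (set_coord v r a%:R).
Proof.
move=> pp rm hp /=; rewrite sum_Fp //; apply: eq_bigr => a _.
by rewrite set_coord_set_coord coordn_set_coord // !val_Fp_nat // !modn_small
  ?exprVn.
Qed.

(** The vectors with r-th coordinate 0 represent the lines parallel to the r-th
    axis; the p translates of their set along this axis are disjoint. *)
Lemma card_lines (p m r : nat) : prime p -> (r < m)%N ->
  (#|[set v : 'cV['F_p]_m | coordn v r == 0%R]%SET| * p <= p ^ m)%N.
Proof.
move=> pp rm; set S := finset _.
have inj : {in finset.setX [set: 'F_p]%SET S &,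
    injective (fun bv => set_coord bv.2 r bv.1)}.
  move=> [b v] [b' v']; rewrite !inE /= => /eqP v0 /eqP v'0 E.
  have bb : b = b'.
    by rewrite -(coordn_set_coord v b rm) E coordn_set_coord.
  by rewrite -bb -(set_coord_id v r) -(set_coord_id v' r) v0 v'0
    -(set_coord_set_coord v r b) E -bb set_coord_set_coord.
have := card_in_imset inj; rewrite cardsX cardsT card_Fp // mulnC => <-.
have <- : #|{: 'cV['F_p]_m}| = (p ^ m)%N by rewrite card_mx card_Fp // muln1.
exact: max_card.
Qed.

Definition fft_values (R : realType) (p m s : nat) (C : 'I_s -> 'M['F_p]_m)
    (r : nat) : set (('rV[R]_s -> R[i]) -> R[i]) :=
  [set g | exists v : 'cV['F_p]_m, g = fun f => fft C f r v].
Arguments fft_values R {p m s} C r.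

(** One step of the recursion is a Fourier transform of length p along each
    line parallel to the r-th axis. *)
Lemma computable_fft_level (R : realType) (p m s : nat)
    (C : 'I_s -> 'M['F_p]_m) (r k : nat) :
  prime p -> (r < m)%N -> (2 * p <= 2 ^ k)%N ->
  computable (samples C) (p ^ m.-1 * (4 * k * 2 ^ k + 2 ^ k + 2 * p + 1))
    (fft_values R C r) (fft_values R C r.+1).
Proof.
move=> pp rm pk; set c := (_ + 1)%N.
have sN f : size (samples (R := R) C f) = (p ^ m)%N.
  by rewrite size_map size_iota.
(* One representative of each line parallel to the r-th axis. *)
pose S : {set 'cV['F_p]_m} := [set v : 'cV['F_p]_m | coordn v r == 0]%SET.
pose line r' (v : 'cV['F_p]_m) (a : nat) : ('rV[R]_s -> R[i]) -> R[i] :=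
  fun f => fft C f r' (set_coord v r a%:R).
have Cline v : v \in enum S ->
    computable (samples C) c (fft_values R C r) (first_terms p (line r.+1 v)).
  move=> _; have -> : first_terms p (line r.+1 v) = first_terms p (fun h f =>
      \sum_(a < p) (omega R p)^-1 ^+ (a * h) * line r v a f).
    by apply/seteqP; split=> _ [h hp ->]; exists h => //; apply/funext => f;
      rewrite /line -?fft_step // fft_step.
  have p0 := prime_gt0 pp.
  apply: (@computable_le _ _ _ c c (first_terms p (line r v)) _ _ _ (leqnn _) _
    (@subset_refl _ _)).
    by move=> _ [a _ ->]; exists (set_coord v r a%:R).
  apply: (computable_chirp sN (prim_root_omega R k)) => //.
    by rewrite pnatr_eq0 expn_eq0.
  by rewrite invr_eq0 omega_neq0.
apply: (computable_le _ (@subset_refl _ _) _ (computable_bigcup Cline)).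
  rewrite leq_mul2r -cardE; apply/orP; right.
  rewrite -(leq_pmul2r (prime_gt0 pp)) -expnSr prednK; last by case: (m) rm.
  exact: card_lines.
move=> _ [v ->]; exists (set_coord v r 0).
  by rewrite mem_enum inE coordn_set_coord.
exists (coordn v r); first exact: ltn_Fp.
apply/funext => f; rewrite /line set_coord_set_coord natr_Zp.
by rewrite set_coord_id.
Qed.

Lemma computable_fft (R : realType) (p m s : nat)
    (C : 'I_s -> 'M['F_p]_m) (k : nat) :
  prime p -> (2 * p <= 2 ^ k)%N ->
  computable (samples C)
    (m * (p ^ m.-1 * (4 * k * 2 ^ k + 2 ^ k + 2 * p + 1)) + p ^ m)
    (fft_values R C 0)
    [set g | exists v : 'cV['F_p]_m,
       g = fun f => (p ^ m)%:R^-1 * fft C f m v].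
Proof.
move=> pp pk; set c := (p ^ m.-1 * _)%N.
have Cr r : (r <= m)%N ->
    computable (samples C) (r * c) (fft_values R C 0) (fft_values R C r).
  elim: r => [|r IH] rm; first exact: computable_sub.
  rewrite mulSnr; apply: computable_trans (IH (ltnW rm)) _.
  exact: computable_fft_level.
apply: computable_trans (Cr m (leqnn m)) _.
have sN f : size (samples (R := R) C f) = (p ^ m)%N.
  by rewrite size_map size_iota.
have Cscale v : v \in enum {: 'cV['F_p]_m} -> computable (samples C) 1
    (fft_values R C m) [set fun f => (p ^ m)%:R^-1 * fft C f m v].
  by move=> _; apply: (computable_scale _ sN); exists v.
apply: (computable_le _ (@subset_refl _ _) _ (computable_bigcup Cscale)).
  by rewrite -cardE card_mx card_Fp // !muln1.
by move=> _ [v ->]; exists v; rewrite ?mem_enum.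
Qed.

(** With l the integral part of the base 2 logarithm of p, the length
    2 ^ k = 4 * 2 ^ l is at most 4 p, and k <= 3 l since l >= 1. So a line costs
    at most 16 k p + 7 p <= 55 l p operations, the final scaling adds at most
    m p ^ m l, and l <= ln p / ln 2. *)
Lemma fft_cost_bound (R : realType) (p m k : nat) :
  (1 < p)%N -> (0 < m)%N -> k = (trunc_log 2 p).+2 ->
  (m * (p ^ m.-1 * (4 * k * 2 ^ k + 2 ^ k + 2 * p + 1)) + p ^ m)%:R <=
  56 / ln 2 * (m * p ^ m)%:R * ln (p%:R : R).
Proof.
move=> p1 m0 ->.
have p0 : (0 < p)%N by apply: ltnW.
have l0 : (0 < trunc_log 2 p)%N by rewrite trunc_log_gt0; lia.
have lp : (2 ^ trunc_log 2 p <= p)%N by apply: trunc_logP.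
set l := trunc_log 2 p in l0 lp *.
have ln2 : 0 < ln 2 :> R by rewrite ln_gt0 // ltr1n.
have lnp : l%:R <= ln p%:R / ln 2 :> R.
  rewrite ler_pdivlMr // mulr_natl -lnXn // ler_ln ?posrE ?exprn_gt0 ?ltr0n //.
  by rewrite -natrX ler_nat.
have cost : (4 * l.+2 * 2 ^ l.+2 + 2 ^ l.+2 + 2 * p + 1 <= 55 * l * p)%N.
  rewrite !expnS; move: (2 ^ l)%N lp => q; nia.
have total : (m * (p ^ m.-1 * (4 * l.+2 * 2 ^ l.+2 + 2 ^ l.+2 + 2 * p + 1)) +
    p ^ m <= 56 * (m * p ^ m * l))%N.
  have pm : (p ^ m = p ^ m.-1 * p)%N by rewrite -expnSr prednK.
  have : (m * (p ^ m.-1 * (4 * l.+2 * 2 ^ l.+2 + 2 ^ l.+2 + 2 * p + 1)) <=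
      m * (p ^ m.-1 * (55 * l * p)))%N by rewrite !leq_mul2l cost !orbT.
  have : (p ^ m <= m * p ^ m * l)%N.
    by rewrite -mulnA mulnCA leq_pmulr // muln_gt0 m0.
  have -> : (m * (p ^ m.-1 * (55 * l * p)) = 55 * (m * p ^ m * l))%N.
    by rewrite pm; ring.
  by lia.
apply: (@le_trans _ _ (56 * (m * p ^ m * l))%:R); first by rewrite ler_nat.
have -> : 56 / ln 2 * (m * p ^ m)%:R * ln p%:R =
    (56 * (m * p ^ m))%:R * (ln p%:R / ln 2) :> R.
  by rewrite [in RHS]natrM; ring.
by rewrite mulnA natrM ler_wpM2l // ler0n.
Qed.

Lemma stored_samples (R : realType) (p m s : nat) (C : 'I_s -> 'M['F_p]_m) g :
  prime p -> fft_values R C 0 g -> stored (samples C) [::] g.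
Proof.
move=> pp [v ->]; have vi := vec_index_lt v pp.
exists (vec_index v) => f /=; rewrite ?size_map ?size_iota //.
by rewrite (nth_map 0%N) ?size_iota // nth_iota.
Qed.

Theorem mainTheorem1 (R : realType) :
  exists c1 c2 : R,
  forall (p m s : nat) (C : 'I_s -> 'M['F_p]_m),
    prime p -> (0 < m)%N -> (0 < s)%N ->
    (forall h : 'cV['F_p]_m, exists k : s.-tuple nat, dual_mul C k = h) ->
    [/\ (forall (f : 'rV[R]_s -> R[i]) (k : s.-tuple nat), wavenumber C k ->
           walsh_coef C f k = (p ^ m)%:R^-1 * fft C f m (dual_mul C k)),
        (forall f : 'rV[R]_s -> R[i],
           let mem := run (fft_program R p m) (samples C f) in
           (forall (r : nat) (v : 'cV['F_p]_m), (r <= m)%N ->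
              nth 0 mem (entry_cell r v) = fft C f r v) /\
           (forall k : s.-tuple nat, wavenumber C k ->
              nth 0 mem (output_cell (dual_mul C k)) = walsh_coef C f k)),
        (size (fft_program R p m))%:R <= c1 * (m * p ^ m.+1)%:R
      & exists (P : slp R[i]) (out : 'cV['F_p]_m -> nat),
          (size P)%:R <= c2 * (m * p ^ m)%:R * ln (p%:R : R) /\
          forall (f : 'rV[R]_s -> R[i]) (k : s.-tuple nat), wavenumber C k ->
            nth 0 (run P (samples C f)) (out (dual_mul C k))
              = walsh_coef C f k].
Proof.
exists 3, (56 / ln 2) => p m s C pp m0 _ _; split.
- by move=> f k _; apply: walsh_coef_fft.
- move=> f mem; have [_ levels out] := run_fft_program C f pp.
  by split=> // k _; rewrite walsh_coef_fft.
- have p0 := prime_gt0 pp.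
  rewrite size_fft_program // -natrM ler_nat expnS.
  have : (p ^ m <= m * (p * p ^ m))%N by rewrite mulnA leq_pmull // muln_gt0 m0.
  by lia.
pose k := (trunc_log 2 p).+2.
have pk : (2 * p <= 2 ^ k)%N.
  by rewrite expnS leq_mul2l /= ltnW // trunc_log_ltn.
have [P szP outP] := @computable_fft R p m s C k pp pk [::]
  (fun g => stored_samples pp).
rewrite cat0s in outP.
have [out _ outE] := fin_all_exists2 (fun v => outP _ (ex_intro _ v erefl)).
exists P, out; split.
  apply: le_trans (fft_cost_bound R (prime_gt1 pp) m0 (erefl k)).
  by rewrite ler_nat.
by move=> f k' _; rewrite walsh_coef_fft.
Qed.
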